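(* Consider the hybrid system with flow and event updates described in the context, on a directed, weight-balanced, strongly connected weighted graph with $N$ agents. Suppose each agent $i\in\{1,\dots,N\}$ implements the distributed dynamic event-triggered coordination algorithm described in the context, with each event of agent $i$ triggered at most $\Delta_i$ seconds after the robust trigger condition $h_i(v_i)\le\Delta_i$ becomes satisfied, where $\sigma_i\in(0,1)$, $\Delta_i\in[0,\sigma_i/d_i)$, and $$h_i(v_i)=\begin{cases}\dfrac{\sigma_i}{d_i}\left(1-\dfrac{e_i^2}{\chi_i+e_i^2}\right), & (\chi_i,e_i)\ne(0,0),\\[2mm] \dfrac{\sigma_i}{d_i}, & \text{otherwise.}\end{cases}$$ Then all trajectories of the system asymptotically converge to the set $$\{q:\ \hat{\phi}_i=0\ \text{ for all } i\in\{1,\dots,N\}\}.$$ Additionally, for all $i\in\{1,\dots,N\}$, the inter-event times of agent $i$ are lower-bounded by $$\tilde{T}_i:=\frac{\sigma_i}{d_i}-\Delta_i>0 .$$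
   Context: Graph. $\mathcal{G}$ is a directed, weight-balanced, strongly connected graph on vertices $\{1,\dots,N\}$, $N\ge 2$, with edge set $\mathcal{E}$ and weights $w_{ij}>0$ for $(i,j)\in\mathcal{E}$. If $(i,j)\in\mathcal{E}$, $j$ is an out-neighbor of $i$; $\mathcal{N}_i^{\text{out}}$ is the set of out-neighbors of $i$. The degree is $d_i=\sum_{j\in\mathcal{N}_i^{\text{out}}}w_{ij}$; weight-balanced means this out-degree equals the in-degree $\sum_{j:(j,i)\in\mathcal{E}}w_{ji}$ for every $i$. The Laplacian is $L=\mathrm{diag}(d_1,\dots,d_N)-A$, with $A$ the weighted adjacency matrix (entries $w_{ij}$). State. Agent $i$ has a physical state $x_i\in\mathbb{R}$, a last broadcast state $\hat{x}_i\in\mathbb{R}$, and a clock-like variable $\chi_i\in\mathbb{R}$; $q_i=(x_i,\hat{x}_i,\chi_i)$ and $q=(q_1,\dots,q_N)\in\mathbb{R}^{3N}$. The information locally available to agent $i$ is $v_i=(q_i,\{\hat{x}_j\}_{j\in\mathcal{N}_i^{\text{out}}})$. Define $$e_i=x_i-\hat{x}_i,\qquad \hat{z}_i=(L\hat{x})_i=\sum_{j\in\mathcal{N}_i^{\text{out}}}w_{ij}(\hat{x}_i-\hat{x}_j),\qquad \hat{\phi}_i=\sum_{j\in\mathcal{N}_i^{\text{out}}}w_{ij}(\hat{x}_i-\hat{x}_j)^2 .$$ Flow (between events). $$\dot{x}_i=-\hat{z}_i,\qquad \dot{\hat{x}}_i=0,\qquad \dot{\chi}_i=\sigma_i\hat{\phi}_i+2e_i\hat{z}_i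 \qquad\text{for all } i,$$ on the flow set $\{q:\chi_i\ge 0\ \forall i\}$. Events. An event of agent $i$ replaces $\hat{x}_i$ by $x_i$ (agent $i$ broadcasts its state to its in-neighbors) and leaves all other components of $q$ unchanged. Several agents may have events at the same time. Algorithm with delayed, robust trigger. At $t=0$ each agent sets $\hat{x}_i(0)=x_i(0)$ (arbitrary) and $\chi_i(0)=0$; set $t_0^i=0$. Given agent $i$'s event time $t^i_\ell$, let $t^{i*}_{\ell+1}$ be the first time $t\ge t^i_\ell$ (after the update at $t_\ell^i$) at which $h_i(v_i(t))\le\Delta_i$ holds; the next event of agent $i$ takes place at $t^i_{\ell+1}=t^{i*}_{\ell+1}+\delta t^i_\ell$ with an arbitrary detection delay $\delta t^i_\ell\in[0,\Delta_i]$ (and there is no further event if the condition is never satisfied). The jump-set condition $h_i(v_i)\in[0,\Delta_i]$ thus replaces the nominal trigger condition ''$\chi_i=0$ and $e_i\ne0$''. The control input of agent $i$ is always $u_i=-\hat{z}_i$. Inter-event times being lower-bounded by $\tilde{T}_i$ means $t^i_{\ell+1}-t^i_\ell\ge\tilde{T}_i$ for all $\ell\in\mathbb{Z}_{\ge0}$. Asymptotic convergence of a trajectory to a set means that the Euclidean distance from $q(t)$ to the set tends to $0$ as $t\to\infty$. *)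

(* Defs.v *)
From HB Require Import structures.
From mathcomp Require Import all_boot all_order all_algebra.
From mathcomp Require Import all_classical all_reals all_analysis.
Set Implicit Arguments.
Unset Strict Implicit.
Unset Printing Implicit Defensive.
Import Order.TTheory GRing.Theory Num.Theory.
Import numFieldNormedType.Exports.
Local Open Scope classical_set_scope.
Local Open Scope ring_scope.

Record wdigraph (R : realType) (N : nat) := Wdigraph {
  edge : rel 'I_N;
  weight : 'I_N -> 'I_N -> R;
  weight_gt0 : forall i j, edge i j -> 0 < weight i j }.

Section Graph.
Variables (R : realType) (N : nat) (G : wdigraph R N).

(* Weights off the edge set are irrelevant, hence masked. *)
Definition adjacency : 'M[R]_N :=
  \matrix_(i, j) (if edge G i j then weight G i j else 0).

Definition degree (i : 'I_N) : R := \sum_(j | edge G i j) weight G i j.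

Definition in_degree (i : 'I_N) : R := \sum_(j | edge G j i) weight G j i.

Definition weight_balanced : Prop := forall i, degree i = in_degree i.

Definition strongly_connected : Prop := forall i j, connect (edge G) i j.

Definition laplacian : 'M[R]_N := diag_mx (\row_i degree i) - adjacency.

End Graph.

Record agent_state (R : realType) := AgentState {
  phys : R;    (* x_i *)
  bcast : R;   (* \hat x_i *)
  clock : R }. (* \chi_i *)

Definition state (R : realType) (N : nat) := 'I_N -> agent_state R.

Section State.
Variables (R : realType) (N : nat) (G : wdigraph R N).

Definition err (qi : agent_state R) : R := phys qi - bcast qi.

Definition zhat (q : state R N) (i : 'I_N) : R :=
  (laplacian G *m \col_j bcast (q j)) i 0.

Lemma zhatE (q : state R N) (i : 'I_N) :
  zhat q i =
  \sum_(j | edge G i j) weight G i j * (bcast (q i) - bcast (q j)).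
Proof.
rewrite /zhat /laplacian mulmxBl mul_diag_mx !mxE /degree mulr_suml.
under [X in _ - X]eq_bigr => j _ do rewrite !mxE.
rewrite [X in _ - X](bigID (edge G i)) /= [X in _ - (_ + X)]big1 ?addr0.
  by rewrite -sumrB; apply: eq_bigr => j eij; rewrite eij mulrBr.
by move=> j /negbTE ->; rewrite mul0r.
Qed.

Definition phihat (q : state R N) (i : 'I_N) : R :=
  \sum_(j | edge G i j) weight G i j * (bcast (q i) - bcast (q j)) ^+ 2.

Definition target_set : set (state R N) := [set q | forall i, phihat q i = 0].

(* Euclidean distance of R^(3N). *)
Definition euclid_dist (p q : state R N) : R :=
  Num.sqrt (\sum_i ((phys (p i) - phys (q i)) ^+ 2
                    + (bcast (p i) - bcast (q i)) ^+ 2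
                    + (clock (p i) - clock (q i)) ^+ 2)).

Definition dist_to (A : set (state R N)) (q : state R N) : R :=
  inf [set euclid_dist q p | p in A].

(* The trigger function uses no neighbor data: of v_i it only reads q_i. *)
Definition trigger_fun (sigma d : R) (qi : agent_state R) : R :=
  if (clock qi, err qi) != (0, 0)
  then sigma / d * (1 - err qi ^+ 2 / (clock qi + err qi ^+ 2))
  else sigma / d.

End State.

Section Trajectory.
Variables (R : realType) (N : nat) (G : wdigraph R N).
Variables (sigma Delta : 'I_N -> R).

(* [tev i l = Some t] means that the l-th event of agent i takes place at
   time t, and [tev i l = None] that agent i has at most l events (numbered
   0, ..., l - 1).  [q t] is the state after the events at time t, if any. *)
Variables (q : R -> state R N) (tev : 'I_N -> nat -> option R).

(* State of agent i at time t when its latest event is the one of time t0.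
   It differs from [q t i] when agent i has an event at time t > t0: it is
   then the state immediately before that event, which is the one on which
   the trigger condition has to be evaluated. *)
Definition held_state (i : 'I_N) (t0 t : R) : agent_state R :=
  AgentState (phys (q t i)) (phys (q t0 i)) (clock (q t i)).

Definition triggered (i : 'I_N) (t0 t : R) : Prop :=
  trigger_fun (sigma i) (degree G i) (held_state i t0 t) <= Delta i.

Definition first_triggered (i : 'I_N) (t0 ts : R) : Prop :=
  [/\ t0 <= ts, triggered i t0 ts
    & forall s, t0 <= s -> s < ts -> ~ triggered i t0 s].

Definition event_schedule : Prop :=
  forall i, tev i 0%N = Some 0 /\
    forall l, match tev i l with
      | None => tev i l.+1 = None
      | Some t0 =>
          (exists ts dt : R, [/\ first_triggered i t0 ts, 0 <= dt <= Delta i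
                           & tev i l.+1 = Some (ts + dt)])
          \/ ((forall s, t0 <= s -> ~ triggered i t0 s) /\ tev i l.+1 = None)
      end.

(* Events leave x and chi unchanged, so these are continuous for all time;
   \hat x_i is constant between two events of agent i and is set to x_i at
   each of them. *)
Definition broadcast_rule : Prop :=
  forall i l t0 t, tev i l = Some t0 -> t0 <= t ->
    (forall t1, tev i l.+1 = Some t1 -> t < t1) ->
    bcast (q t i) = phys (q t0 i).

Definition continuity_rule : Prop :=
  forall i, {within `[0, +oo[, continuous (fun t : R => phys (q t i))} /\
            {within `[0, +oo[, continuous (fun t : R => clock (q t i))}.

Definition event_free (a b : R) : Prop :=
  forall i l t, tev i l = Some t -> ~ (a < t < b).

Definition flow_rule : Prop :=
  forall a b t : R, 0 <= a -> event_free a b -> a < t < b -> forall i,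
    is_derive t (1 : R) (fun s => phys (q s i)) (- zhat G (q t) i) /\
    is_derive t (1 : R) (fun s => clock (q s i))
      (sigma i * phihat G (q t) i + 2 * err (q t i) * zhat G (q t) i).

Definition initial_rule : Prop :=
  forall i, bcast (q 0 i) = phys (q 0 i) /\ clock (q 0 i) = 0.

(* Neither membership in the flow set {chi_i >= 0} nor the absence of
   accumulating event times is required here.  An execution that would leave
   the flow set, or that would be Zeno, thus still counts as a trajectory. *)
Definition trajectory : Prop :=
  [/\ initial_rule, continuity_rule, flow_rule, broadcast_rule
    & event_schedule].

End Trajectory.

Definition flow_set (R : realType) (N : nat) : set (state R N) :=
  [set q | forall i, 0 <= clock (q i)].

(* Main.v *)
Require Import Defs.
From HB Require Import structures.
From mathcomp Require Import all_boot all_order all_algebra.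
From mathcomp Require Import all_classical all_reals all_analysis.
From mathcomp Require Import ring lra.
Set Implicit Arguments.
Unset Strict Implicit.
Unset Printing Implicit Defensive.
Import Order.TTheory GRing.Theory Num.Theory.
Import numFieldNormedType.Exports.
Local Open Scope classical_set_scope.
Local Open Scope ring_scope.

(** Write e_i for the error phys - bcast of agent i and r_i for
    sigma_i / degree i.

    Between two events of agent i the energy Y_i = clock + e_i^2 grows at the
    rate sigma_i phihat_i, since the terms 2 e_i zhat_i in the derivatives of
    the clock and of e_i^2 cancel.  In the same period e_i moves at the speed
    zhat_i, and zhat_i^2 <= degree i * phihat_i by Cauchy-Schwarz.  Therefore
    r_i (e_i(b) - e_i(a))^2 <= (b - a) (Y_i(b) - Y_i(a)) on every part [a, b]
    of the period ([energy_growth]).  The trigger condition says that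
    r_i e_i^2 >= (r_i - Delta_i) Y_i; as e_i vanishes just after an event, it
    cannot hold before a time gap i = r_i - Delta_i has passed ([gap_le]).
    Up to the first time at which it holds, r_i e_i^2 <= (r_i - Delta_i) Y_i,
    and a further delay of at most Delta_i can only raise this to e_i^2 <= Y_i,
    which means that the clock stays nonnegative ([clock_ge0_step]).

    These estimates are summed over the finitely many events of a bounded
    time interval, so they presuppose that the execution is not Zeno.  They are
    therefore proved up to a time tau before which every inter-event time is
    long enough ([separated]), which leaves only finitely many events before
    tau.  If some inter-event time were too short, there would be one that ends
    first among all agents, and the estimates hold up to its end; so it is not
    too short ([no_early_event]).

    For the convergence, let [lyap] be the sum over i of
    x_i^2 + chi_i + lambda_i Y_i with lambda_i = (1 - sigma_i) / (2 sigma_i).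
    Weight balance makes the flow decrease it at the rate
    sum_i (1 - sigma_i) / 2 * phihat_i, and an event of agent i decreases it
    by lambda_i times the square of the jump of bcast ([lyap_step]).  The term
    lambda_i Y_i is what turns events into a strict decrease: without it they
    would be invisible, and clusters of almost simultaneous events could not be
    excluded.  As [lyap] is nonnegative, its variation after time t tends to 0;
    so the jumps of bcast tend to 0, and so does the integral of phihat_i over
    windows of fixed length.  Along an edge (i, j), a window shorter than gap i
    and gap j contains at most one event of i and one of j, so the difference of
    their broadcast states hardly varies on it; if it were not small at the
    beginning, phihat_i would be large on the whole window
    ([edge_bcast_cvg]).  Strong connectivity spreads this to all pairs of
    agents, and replacing all broadcast states by that of one agent gives a
    point of the target set close to q t ([dist_to_target_le]). *)

(** * Algebra of the error bound *)

(** The bound r u^2 <= p A, with p a duration and A an energy increment, is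
    additive; this is the Cauchy-Schwarz inequality
    (sqrt (p A) + sqrt (p' A'))^2 <= (p + p') (A + A').  It is what allows a
    bound valid on event-free pieces to be chained across the events of other
    agents. *)
Lemma sqr_add_le (R : realFieldType) (r u v p A p' A' : R) :
  0 < r -> 0 <= p -> 0 <= A -> 0 <= p' -> 0 <= A' ->
  r * u ^+ 2 <= p * A -> r * v ^+ 2 <= p' * A' ->
  r * (u + v) ^+ 2 <= (p + p') * (A + A').
Proof.
move=> r0 p0 A0 p'0 A'0 hu hv.
suff : 2 * (r * u * v) <= p * A' + p' * A.
  move=> h; rewrite sqrrD -mulr_natl !mulrDr !mulrDl; nra.
apply: le_trans (ler_norm _) _.
have pA'0 : 0 <= p * A' + p' * A by rewrite addr_ge0 ?mulr_ge0.
rewrite -(ler_pXn2r (n := 2)) ?nnegrE ?normr_ge0 // real_normK ?num_real //.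
have huv : (r * u ^+ 2) * (r * v ^+ 2) <= (p * A) * (p' * A').
  by apply: ler_pM => //; rewrite mulr_ge0 ?sqr_ge0 // ltW.
have := sqr_ge0 (p * A' - p' * A); lra.
Qed.

(** * The Laplacian *)

Section Graph.
Variables (R : realType) (N : nat) (G : wdigraph R N).

Lemma phihat_ge0 (p : state R N) i : 0 <= phihat G p i.
Proof.
by apply: sumr_ge0 => j ij; rewrite mulr_ge0 ?sqr_ge0 // ltW ?weight_gt0.
Qed.

Lemma le_phihat (p : state R N) i j : edge G i j ->
  weight G i j * (bcast (p i) - bcast (p j)) ^+ 2 <= phihat G p i.
Proof.
move=> ij; rewrite /phihat (bigD1 j) //= lerDl sumr_ge0 // => k /andP[ik _].
by rewrite mulr_ge0 ?sqr_ge0 // ltW ?weight_gt0.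
Qed.

Lemma eq_zhat (p p' : state R N) i :
  (forall j, bcast (p j) = bcast (p' j)) -> zhat G p i = zhat G p' i.
Proof. by move=> pp'; rewrite !zhatE; under eq_bigr do rewrite !pp'. Qed.

Lemma eq_phihat (p p' : state R N) i :
  (forall j, bcast (p j) = bcast (p' j)) -> phihat G p i = phihat G p' i.
Proof. by move=> pp'; rewrite /phihat; under eq_bigr do rewrite !pp'. Qed.

(** Cauchy-Schwarz in variance form: with d the degree and z = zhat, the
    weighted sum of the squares of d * (x_i - x_j) - z is
    d * (d * phihat - z^2). *)
Lemma zhat_sqr_le (p : state R N) i : 0 < degree G i ->
  zhat G p i ^+ 2 <= degree G i * phihat G p i.
Proof.
have [d dE] : exists d, degree G i = d by exists (degree G i).
have [z zE] : exists z, zhat G p i = z by exists (zhat G p i).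
rewrite dE zE => d0; rewrite zhatE in zE.
suff : 0 <= d * (d * phihat G p i - z ^+ 2) by rewrite pmulr_rge0 // subr_ge0.
suff -> : d * (d * phihat G p i - z ^+ 2) = \sum_(j | edge G i j)
    weight G i j * (d * (bcast (p i) - bcast (p j)) - z) ^+ 2.
  by apply: sumr_ge0 => j ij; rewrite mulr_ge0 ?sqr_ge0 // ltW ?weight_gt0.
transitivity (d ^+ 2 * phihat G p i - 2 * d * z * z + z ^+ 2 * d).
  by ring.
rewrite -{2}zE /phihat -{3}dE /degree !mulr_sumr -sumrB -big_split /=.
by apply: eq_bigr => j _; ring.
Qed.

(** The two summands differ by w_ij (x_i^2 - x_j^2), whose double sum counts
    each x_i^2 with the out-degree minus the in-degree of i. *)
Lemma sum_bcast_zhat (p : state R N) : weight_balanced G ->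
  \sum_i 2 * bcast (p i) * zhat G p i = \sum_i phihat G p i.
Proof.
move=> bal; apply/eqP; rewrite -subr_eq0 -sumrB; apply/eqP.
pose b i := bcast (p i) ^+ 2.
transitivity (\sum_i \sum_(j | edge G i j)
                (weight G i j * b i - weight G i j * b j)).
  apply: eq_bigr => i _; rewrite zhatE /phihat mulr_sumr -sumrB.
  by apply: eq_bigr => j _; rewrite /b; ring.
under eq_bigr do rewrite sumrB; rewrite sumrB.
rewrite [X in _ - X](exchange_big_dep xpredT) //= -sumrB big1 // => i _.
rewrite -!mulr_suml -/(degree G i) -/(in_degree G i) (bal i) subrr //.
Qed.

End Graph.

(** * Event times *)

Section Schedule.
Variables (R : realType) (N : nat) (G : wdigraph R N).
Variables (sigma Delta : 'I_N -> R).
Hypothesis sigma01 : forall i, 0 < sigma i < 1.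
Hypothesis Delta_bounds : forall i, 0 <= Delta i < sigma i / degree G i.
Variables (q : R -> state R N) (tev : 'I_N -> nat -> option R).
Hypothesis hq : trajectory G sigma Delta q tev.

Definition gap i := sigma i / degree G i - Delta i.

Lemma rate_gt0 i : 0 < sigma i / degree G i.
Proof. by have /andP[/le_lt_trans D /D] := Delta_bounds i. Qed.

Lemma degree_gt0 i : 0 < degree G i.
Proof.
have /andP[s0 _] := sigma01 i; have := rate_gt0 i.
by rewrite pmulr_rgt0 // invr_gt0.
Qed.

Lemma gap_gt0 i : 0 < gap i.
Proof. by rewrite subr_gt0; case/andP: (Delta_bounds i). Qed.

Lemma event0 i : tev i 0 = Some 0.
Proof. by have [_ _ _ _ /(_ i)[]] := hq. Qed.

Lemma event_succ i l t1 : tev i l.+1 = Some t1 ->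
  exists2 t0, tev i l = Some t0 & exists ts dt,
    [/\ first_triggered G sigma Delta q i t0 ts, 0 <= dt <= Delta i
      & t1 = ts + dt].
Proof.
have [_ _ _ _ /(_ i)[_ /(_ l)]] := hq.
case: (tev i l) => [t0|] + E; last by rewrite E.
move=> [[ts [dt [H1 H2]]]|[_]]; rewrite E // => -[->].
by exists t0 => //; exists ts, dt.
Qed.

Lemma event_le i l m t1 : (l <= m)%N -> tev i m = Some t1 ->
  exists2 t0, tev i l = Some t0 & t0 <= t1.
Proof.
elim: m t1 => [|m IH] t1; first by rewrite leqn0 => /eqP-> E; exists t1.
rewrite leq_eqVlt => /predU1P[->|lm E]; first by exists t1.
have [t' /(IH _ lm)[t0 E0 t0t'] [ts [dt [[t'ts _ _] /andP[dt0 _] ->]]]] :=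
  event_succ E.
by exists t0 => //; lra.
Qed.

Lemma event_ge0 i l t : tev i l = Some t -> 0 <= t.
Proof. by move=> /(event_le (leq0n l))[t0]; rewrite event0 => -[<-]. Qed.

(** Absence of Zeno behavior before tau, in quantitative form: only the
    inter-event times that end before tau are constrained. *)
Definition separated (tau : R) := forall i l t0 t1,
  tev i l = Some t0 -> tev i l.+1 = Some t1 -> t1 < tau -> gap i <= t1 - t0.

Lemma event_lower tau i l t : separated tau -> tev i l = Some t -> t < tau ->
  l%:R * gap i <= t.
Proof.
move=> sep; elim: l t => [|l IH] t E ttau.
  by rewrite mul0r (event_ge0 E).
have [t0 E0 t0t] := event_le (leqnSn l) E.
have := IH _ E0 (le_lt_trans t0t ttau); have := sep _ _ _ _ E0 E ttau.
rewrite -natr1 mulrDl mul1r; lra.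
Qed.

Lemma event_index tau i l t : separated tau -> tev i l = Some t -> t < tau ->
  (l <= Num.Def.archi_bound (tau / gap i))%N.
Proof.
move=> sep E ttau; rewrite -(ler_nat R).
have tau0 : 0 <= tau := le_trans (event_ge0 E) (ltW ttau).
have gi := gap_gt0 i.
apply/ltW/(le_lt_trans _ (archi_boundP _)); last by rewrite divr_ge0 // ltW.
by rewrite ler_pdivlMr // (le_trans (event_lower sep E ttau)) // ltW.
Qed.

(** If there were no latest event at time t, every event number would be
    reached by time t, against the lower bound on event times. *)
Lemma current_event tau i (t : R) : separated tau -> 0 <= t -> t < tau ->
  exists l t0, [/\ tev i l = Some t0, t0 <= t
                 & forall t1, tev i l.+1 = Some t1 -> t < t1].
Proof.
move=> sep t0 ttau; apply: contrapT => no.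
have all_le l : exists2 t', tev i l = Some t' & t' <= t.
  elim: l => [|l [t' E t't]]; first by exists 0; rewrite ?event0.
  apply: contrapT => no'; apply: no; exists l, t'; split=> // t1 E1.
  by rewrite ltNge; apply/negP => t1t; apply: no'; exists t1.
have [t' E t't] := all_le (Num.Def.archi_bound (tau / gap i)).+1.
by have := event_index sep E (le_lt_trans t't ttau); rewrite ltnn.
Qed.

Lemma eq_bcast tau i (a s : R) : separated tau -> 0 <= a -> a < tau -> a <= s ->
  (forall l t, tev i l = Some t -> ~ (a < t <= s)) ->
  bcast (q s i) = bcast (q a i).
Proof.
move=> sep a0 atau as_ none; have [_ _ _ br _] := hq.
have [l [t0 [E t0a nx]]] := current_event i sep a0 atau.
rewrite (br _ _ _ _ E t0a nx); apply: (br _ _ _ _ E (le_trans t0a as_)).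
move=> t1 E1; rewrite ltNge; apply/negP => t1s.
by apply: (none _ _ E1); rewrite nx.
Qed.

(** The broadcast rule reads bcast off the current event at time t.  That event
    is numbered at least l and takes place by time t, hence exactly at t. *)
Lemma bcast_event tau i l t : separated tau -> tev i l = Some t -> t < tau ->
  bcast (q t i) = phys (q t i).
Proof.
move=> sep E ttau; have [_ _ _ br _] := hq.
have [m [t0 [E0 t0t nx]]] := current_event i sep (event_ge0 E) ttau.
suff e : t0 = t by rewrite (br _ _ _ _ E0 t0t nx) e.
apply/eqP; rewrite eq_le t0t /= leNgt; apply/negP => t0lt.
have [lm|ml] := leqP l m.
  have [t'] := event_le lm E0.
  by rewrite E => -[<-]; rewrite leNgt t0lt.
have [t1 /nx] := event_le ml E.
by rewrite ltNge => /negP.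
Qed.

Lemma finitely_many_events tau : separated tau ->
  exists S : seq R, forall i l t, tev i l = Some t -> t < tau -> t \in S.
Proof.
move=> sep.
pose K := \max_i (Num.Def.archi_bound (tau / gap i)).+1.
exists [seq odflt 0 (tev i l) | i <- enum 'I_N, l <- iota 0 K].
move=> i l t E ttau; apply/allpairsP; exists (i, l) => /=.
rewrite mem_enum mem_iota E /= add0n; split=> //.
have le_K :=
  leq_bigmax (F := fun i => (Num.Def.archi_bound (tau / gap i)).+1) i.
by apply: leq_trans le_K; rewrite ltnS (event_index sep E).
Qed.

(** A property of intervals that is stable under concatenation needs to be
    checked only on intervals whose interior contains no event of any agent:
    cut at the finitely many event times, by induction on a list that contains
    them. *)
Lemma interval_ind tau (lo hi : R) (Q : R -> R -> Prop) : separated tau ->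
  hi <= tau -> lo <= hi -> (forall a, Q a a) ->
  (forall a b, lo <= a -> a < b -> b <= hi -> event_free tev a b -> Q a b) ->
  (forall a b c, lo <= a -> a <= b -> b <= c -> c <= hi ->
     Q a b -> Q b c -> Q a c) ->
  Q lo hi.
Proof.
move=> sep hitau lohi refl base trans.
have [S HS] := finitely_many_events sep.
have {HS} : forall i l t, tev i l = Some t -> lo < t < hi -> t \in S.
  by move=> i l t E /andP[_ ?]; apply: HS E _; lra.
suff gen a b : lo <= a -> a <= b -> b <= hi ->
    (forall i l t, tev i l = Some t -> a < t < b -> t \in S) -> Q a b.
  by apply: gen.
elim: S a b => [|x S IH] a b loa ab bhi HS.
  move: ab; rewrite le_eqVlt => /predU1P[<-//|ab]; apply: base => // i l t E.
  by move=> /(HS _ _ _ E).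
have [/andP[ax xb]|xab] := boolP (a < x < b).
  have [ax' xb'] := (ltW ax, ltW xb).
  apply: (trans _ x) => //; apply: IH => //; try exact: le_trans bhi.
  - move=> i l t E /andP[at_ tx]; have := HS i l t E; rewrite in_cons at_ /=.
    by rewrite (lt_trans tx xb) lt_eqF //=; exact.
  - exact: le_trans ax'.
  move=> i l t E /andP[at_ tx]; have := HS i l t E; rewrite in_cons tx /=.
  by rewrite (lt_trans ax at_) gt_eqF //=; exact.
apply: IH => // i l t E tab; have := HS i l t E tab.
by rewrite in_cons => /predU1P[xt|//]; rewrite -xt tab in xab.
Qed.

(** * The flow between two consecutive events of the network *)

Lemma affine_of_is_derive (f : R -> R) (c a b : R) : 0 <= a -> a < b ->
  {within `[0, +oo[, continuous f} ->
  (forall t, a < t < b -> is_derive t (1 : R) f c) ->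
  f b = f a + c * (b - a).
Proof.
move=> a0 ab cf df.
have sub : `[a, b]%classic `<=` `[0, +oo[%classic.
  move=> x /=; rewrite !in_itv /= andbT => /andP[ax _]; exact: le_trans ax.
have dfI t : t \in `]a, b[%R -> is_derive t (1 : R) f c.
  by rewrite in_itv; exact: df.
have [t _ <-] := MVT (df := fun=> c) ab dfI (continuous_subspaceW sub cf).
by rewrite addrC subrK.
Qed.

(** All broadcast states are constant on [a, b[, hence so are zhat and phihat.
    So the physical states are affine there, and so is the clock plus the
    squared error, where the cross terms 2 e zhat cancel.  The error at b is
    taken with the broadcast state held from a on, which an event at b
    replaces. *)
Lemma flow_step tau (a b : R) i : separated tau -> 0 <= a -> a < b -> a < tau ->
  event_free tev a b ->
  phys (q b i) = phys (q a i) - zhat G (q a) i * (b - a) /\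
  clock (q b i) + (phys (q b i) - bcast (q a i)) ^+ 2 =
  clock (q a i) + (phys (q a i) - bcast (q a i)) ^+ 2 +
    sigma i * phihat G (q a) i * (b - a).
Proof.
move=> sep a0 ab atau free; have [_ /(_ i)[cx cc] fl _ _] := hq.
have held t j : a < t < b -> bcast (q t j) = bcast (q a j).
  move=> /andP[at_ tb]; apply: (eq_bcast sep) => //; first exact: ltW.
  by move=> l t' /free no /andP[at' t't]; apply: no; rewrite at' /=; lra.
have dx t : a < t < b ->
    is_derive t (1 : R) (fun s => phys (q s i)) (- zhat G (q a) i).
  move=> tab; have [+ _] := fl a b t a0 free tab i.
  by rewrite (@eq_zhat _ _ _ (q t) (q a)) // => j; exact: held.
split; first by rewrite (affine_of_is_derive a0 ab cx dx) mulNr.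
pose B := bcast (q a i).
apply: (@affine_of_is_derive
  (fun s => clock (q s i) + (phys (q s i) - B) ^+ 2)) => //.
  have cxB : {within `[0, +oo[, continuous (fun t : R => phys (q t i) - B)}.
    by move=> z; apply: cvgB; [exact: cx | exact: cvg_cst].
  by move=> z; exact: cvgD (cc z) (cvgM (cxB z) (cxB z)).
move=> t tab; have [_ dc] := fl a b t a0 free tab i.
have {}dx := dx t tab.
have dB := is_deriveB dx (is_derive_cst B t 1).
apply: (is_derive_eq (is_deriveD dc (is_deriveM dB dB))).
rewrite (@eq_zhat _ _ _ (q t) (q a)); last by move=> j; exact: held.
rewrite (@eq_phihat _ _ _ (q t) (q a)); last by move=> j; exact: held.
rewrite /err held // -/B /GRing.scale /= !fctE; ring.
Qed.

(** * The energy of an agent between its own events *)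

(** The energy clock + error^2, with the broadcast state fixed at its value
    after the event of time t0: this is continuous up to and including the time
    of the next event, where the trigger condition has to be evaluated. *)
Definition held_energy i t0 t :=
  clock (q t i) + (phys (q t i) - phys (q t0 i)) ^+ 2.

Lemma held_energyE i t0 t : held_energy i t0 t =
  clock (q t i) + (phys (q t i) - phys (q t0 i)) ^+ 2.
Proof. by []. Qed.

(** On an event-free piece of duration h, the squared increment of the state
    is zhat^2 h^2 <= degree * phihat * h^2 and the energy increment is
    sigma * phihat * h; the pieces add up by [sqr_add_le]. *)
Lemma energy_growth tau i l (t0 a b : R) : separated tau ->
  tev i l = Some t0 -> t0 <= a -> a <= b -> b <= tau ->
  (forall t1, tev i l.+1 = Some t1 -> b <= t1) ->
  held_energy i t0 a <= held_energy i t0 b /\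
  sigma i / degree G i * (phys (q b i) - phys (q a i)) ^+ 2 <=
    (b - a) * (held_energy i t0 b - held_energy i t0 a).
Proof.
move=> sep E t0a ab btau nx.
have r0 := rate_gt0 i.
have t00 := event_ge0 E.
pose Q a b := held_energy i t0 a <= held_energy i t0 b /\
  sigma i / degree G i * (phys (q b i) - phys (q a i)) ^+ 2 <=
    (b - a) * (held_energy i t0 b - held_energy i t0 a).
apply: (@interval_ind tau a b Q sep) => // {ab}.
- by move=> c; rewrite /Q !subrr expr0n /= !mulr0.
- move=> c d ac cd db free.
  have c0 : 0 <= c by lra.
  have [xd] := flow_step i sep c0 cd (lt_le_trans cd (le_trans db btau)) free.
  have [_ _ _ br _] := hq.
  have -> : bcast (q c i) = phys (q t0 i).
    by apply: (br _ _ _ _ E) => [|t1 /nx]; lra.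
  rewrite -/(held_energy i t0 d) -/(held_energy i t0 c) /Q => ->.
  have f0 : 0 <= sigma i * phihat G (q c) i * (d - c).
    have /andP[s0 _] := sigma01 i.
    by rewrite !mulr_ge0 ?phihat_ge0 ?subr_ge0 // ltW.
  split; first by rewrite lerDl.
  rewrite xd [held_energy i t0 c + _]addrC addrK.
  have -> : phys (q c i) - zhat G (q c) i * (d - c) - phys (q c i) =
    - (zhat G (q c) i * (d - c)) by ring.
  rewrite sqrrN exprMn.
  have z2 := zhat_sqr_le (q c) (degree_gt0 i).
  apply: (@le_trans _ _ (sigma i / degree G i *
    (degree G i * phihat G (q c) i * (d - c) ^+ 2))).
    by rewrite ler_pM2l // ler_wpM2r // sqr_ge0.
  rewrite le_eqVlt; apply/orP; left; apply/eqP; field.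
  by rewrite gt_eqF // degree_gt0.
move=> c d e ac cd de eb [Ycd hcd] [Yde hde]; split; first exact: le_trans Yde.
have := sqr_add_le r0 _ _ _ _ hcd hde.
rewrite !subr_ge0 => /(_ cd Ycd de Yde).
by congr (_ * _ ^+ 2 <= _ * _); ring.
Qed.

Lemma trigger_funE (s d : R) (qi : agent_state R) :
  clock qi + err qi ^+ 2 != 0 ->
  trigger_fun s d qi * (clock qi + err qi ^+ 2) = s / d * clock qi.
Proof.
move=> Y0; rewrite /trigger_fun ifT.
  by move: Y0 => /mulVf YV; rewrite mulrBr mulr1 mulrBl -!mulrA YV; ring.
by apply: contra_neq Y0 => -[-> ->]; rewrite expr0n addr0.
Qed.

Lemma trigger_fun0 (s d : R) (qi : agent_state R) :
  clock qi + err qi ^+ 2 = 0 -> trigger_fun s d qi = s / d.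
Proof.
by move=> Y0; rewrite /trigger_fun Y0 invr0 mulr0 subr0 mulr1 if_same.
Qed.

(** Multiplied by the energy Y, the trigger function is r * clock, that is
    r * Y - r * e^2.  When Y = 0, the division by zero gives the trigger
    function its untriggered value r, also for a nonzero error. *)
Lemma triggered_energy i (t0 t : R) : 0 <= held_energy i t0 t ->
  triggered G sigma Delta q i t0 t ->
  0 < held_energy i t0 t /\
  gap i * held_energy i t0 t <=
    sigma i / degree G i * (phys (q t i) - phys (q t0 i)) ^+ 2.
Proof.
have := @trigger_funE (sigma i) (degree G i) (held_state q i t0 t).
have := @trigger_fun0 (sigma i) (degree G i) (held_state q i t0 t).
rewrite /triggered /err /= -/(held_energy i t0 t).
move: (trigger_fun _ _ _) => h h0 hE Y0 hD.
have Ygt0 : 0 < held_energy i t0 t.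
  rewrite lt_def Y0 andbT; apply/eqP => /h0 h_r.
  by have := gap_gt0 i; rewrite /gap -h_r; lra.
split=> //; have /hE := lt0r_neq0 Ygt0; rewrite /gap.
have := ler_wpM2r (ltW Ygt0) hD; have := held_energyE i t0 t.
by move=> /(congr1 ( *%R (sigma i / degree G i))); lra.
Qed.

Lemma not_triggered_energy i (t0 t : R) : 0 < held_energy i t0 t ->
  ~ triggered G sigma Delta q i t0 t ->
  sigma i / degree G i * (phys (q t i) - phys (q t0 i)) ^+ 2 <=
    gap i * held_energy i t0 t.
Proof.
have := @trigger_funE (sigma i) (degree G i) (held_state q i t0 t).
rewrite /triggered /err /= -/(held_energy i t0 t).
move: (trigger_fun _ _ _) => h hE Ygt0 /negP; rewrite -ltNge => hD.
have /hE := lt0r_neq0 Ygt0; rewrite /gap.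
have := ler_wpM2r (ltW Ygt0) (ltW hD); have := held_energyE i t0 t.
by move=> /(congr1 ( *%R (sigma i / degree G i))); lra.
Qed.

Lemma held_energy_start i t0 : held_energy i t0 t0 = clock (q t0 i).
Proof. by rewrite /held_energy subrr expr0n addr0. Qed.

(** * Inter-event times and nonnegative clocks *)

(** At a triggered time ts, (r - Delta) Y <= r e^2 <= (ts - t0) Y. *)
Lemma gap_le tau i l (t0 ts : R) : separated tau -> tev i l = Some t0 ->
  0 <= clock (q t0 i) -> t0 <= ts -> ts <= tau ->
  (forall t1, tev i l.+1 = Some t1 -> ts <= t1) ->
  triggered G sigma Delta q i t0 ts -> gap i <= ts - t0.
Proof.
move=> sep E c0 t0ts tstau nx trig.
have [Yge eb] := energy_growth sep E (lexx t0) t0ts tstau nx.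
rewrite held_energy_start in Yge eb.
have [Y0 hY] := triggered_energy (le_trans c0 Yge) trig.
rewrite -(ler_pM2r Y0); apply: le_trans hY (le_trans eb _).
by rewrite ler_wpM2l ?subr_ge0 // gerBl.
Qed.

(** It suffices that e^2 <= Y at time t.  For every eps > 0 there is an
    untriggered time s, at most Delta + eps before t: if the condition is
    already satisfied at t, take s just before the first time at which it is.
    Then r e(s)^2 <= (r - Delta) Y(s), and adding the growth from s to t gives
    r e(t)^2 <= (r - Delta + (t - s)) Y(t) <= (r + eps) Y(t). *)
Lemma clock_ge0_step tau i l (t0 t : R) : separated tau ->
  tev i l = Some t0 -> 0 <= clock (q t0 i) -> t0 <= t -> t <= tau ->
  (forall t1, tev i l.+1 = Some t1 -> t <= t1) -> 0 <= clock (q t i).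
Proof.
move=> sep E c0 t0t ttau nx.
have r0 := rate_gt0 i; have /andP[D0 _] := Delta_bounds i.
have [Yge _] := energy_growth sep E (lexx t0) t0t ttau nx.
rewrite held_energy_start in Yge.
have Y0 := le_trans c0 Yge.
suff hs (e : R) : 0 < e -> exists s, [/\ t0 <= s, s <= t, t - s <= Delta i + e
    & ~ triggered G sigma Delta q i t0 s].
  suff : (phys (q t i) - phys (q t0 i)) ^+ 2 <= held_energy i t0 t.
    by rewrite lerDr.
  rewrite -(ler_pM2l r0); apply/ler_addgt0Pr => e e0.
  (* with this choice the excess (t - s - Delta) * Y(t) is at most e *)
  have eY0 : 0 < e / (held_energy i t0 t + 1) by rewrite divr_gt0 //; lra.
  have [s [t0s st tsD ntr]] := hs _ eY0.
  have nxs t1 : tev i l.+1 = Some t1 -> s <= t1.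
    by move=> /nx; apply: le_trans.
  have [Y0s vs] := energy_growth sep E (lexx t0) t0s (le_trans st ttau) nxs.
  rewrite held_energy_start in Y0s vs.
  have [Yst vt] := energy_growth sep E t0s st ttau nx.
  have g0 := gap_gt0 i.
  have us : sigma i / degree G i * (phys (q s i) - phys (q t0 i)) ^+ 2 <=
      gap i * held_energy i t0 s.
    have : 0 <= held_energy i t0 s by exact: le_trans Y0s.
    (* if Y(s) = 0, the energy has not grown since t0, so the error is zero *)
    rewrite le_eqVlt => /predU1P[Ys0|Ys0]; last exact: not_triggered_energy.
    apply: le_trans vs _; rewrite -Ys0 mulr0 sub0r mulrN oppr_le0.
    by rewrite mulr_ge0 ?subr_ge0.
  have := sqr_add_le r0 (ltW g0) (le_trans c0 Y0s) _ _ us vt.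
  rewrite !subr_ge0 => /(_ st Yst).
  have -> : phys (q s i) - phys (q t0 i) + (phys (q t i) - phys (q s i)) =
    phys (q t i) - phys (q t0 i) by ring.
  move=> /le_trans; apply.
  have -> : held_energy i t0 s + (held_energy i t0 t - held_energy i t0 s) =
    held_energy i t0 t by ring.
  apply: (@le_trans _ _ ((sigma i / degree G i + e / (held_energy i t0 t + 1))
    * held_energy i t0 t)).
    by rewrite ler_wpM2r // /gap; lra.
  rewrite mulrDl lerD2l -[leRHS]mulr1 -mulrA ler_pM2l //.
  by rewrite mulrC ler_pdivrMr; lra.
move=> e0; have [_ _ _ _ /(_ i)[_ /(_ l)]] := hq; rewrite E.
case=> [[ts [dt [[t0ts trig first] /andP[dt0 dtD] E1]]]|[none _]]; last first.
  by exists t; split=> //; [lra | exact: none].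
have [tts|tst] := ltP t ts.
  by exists t; split=> //; [lra | exact: first].
have tt1 := nx _ E1.
have ts1 t1 : tev i l.+1 = Some t1 -> ts <= t1 by rewrite E1 => -[<-]; lra.
have := gap_le sep E c0 t0ts (le_trans tst ttau) ts1 trig.
have := gap_gt0 i => g0 gts.
exists (Num.max t0 (ts - e)); split.
- by rewrite le_max lexx.
- by rewrite ge_max t0t /=; lra.
- have : ts - e <= Num.max t0 (ts - e) by rewrite le_max lexx orbT.
  lra.
- apply: first; first by rewrite le_max lexx.
  by rewrite gt_max; apply/andP; split; lra.
Qed.

Lemma clock_event_ge0 tau i l t0 : separated tau -> tev i l = Some t0 ->
  t0 <= tau -> 0 <= clock (q t0 i).
Proof.
move=> sep; elim: l t0 => [|l IH] t1 E t1tau.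
  by move: E; rewrite event0 => -[<-]; have [/(_ i)[_ ->]] := hq.
have [t0 E0 t01] := event_le (leqnSn l) E.
apply: (clock_ge0_step sep E0 _ t01 t1tau); first exact: IH (le_trans t01 _).
by move=> t1'; rewrite E => -[->].
Qed.

Lemma gap_le_next i l (t0 t1 : R) : separated t1 ->
  tev i l = Some t0 -> tev i l.+1 = Some t1 -> gap i <= t1 - t0.
Proof.
move=> sep E0 E1; have [t' + [ts [dt [[t0ts trig _] /andP[dt0 _] t1E]]]] :=
  event_succ E1.
rewrite E0 => -[t0t']; move: t0ts trig; rewrite -{}t0t' => t0ts trig.
apply: (@le_trans _ _ (ts - t0)); last by lra.
have t01 : t0 <= t1 by lra.
have tst1 : ts <= t1 by lra.
apply: (gap_le sep E0 (clock_event_ge0 sep E0 t01) t0ts tst1) trig.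
by move=> t; rewrite E1 => -[<-].
Qed.

Definition early_event i t1 := exists l t0,
  [/\ tev i l = Some t0, tev i l.+1 = Some t1 & t1 - t0 < gap i].

Lemma separated_before_early tau :
  (forall i t1, early_event i t1 -> tau <= t1) -> separated tau.
Proof.
move=> early i l t0 t1 E0 E1 t1tau; rewrite leNgt; apply/negP => lt.
by have := early i t1 (ex_intro _ l (ex_intro _ t0 (And3 E0 E1 lt))); lra.
Qed.

(** Event times increase with their number, so the early event with the least
    number is also the first in time. *)
Lemma first_early_event i : (exists t, early_event i t) ->
  exists2 t1, early_event i t1 & forall t, early_event i t -> t1 <= t.
Proof.
move=> [t0 [l0 et0]].
pose P l := `[< exists t0 t1,
  [/\ tev i l = Some t0, tev i l.+1 = Some t1 & t1 - t0 < gap i] >].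
have exP : exists l, P l.
  by exists l0; apply/asboolP; have [s] := et0; exists s, t0.
have [l /asboolP[s [t1 [E0 E1 lt]]] min] := ex_minnP exP.
exists t1; first by exists l, s.
move=> t [m [s' [E0' E1' lt']]].
have /min lm : P m by apply/asboolP; exists s', t.
have [t' + t't] := @event_le i l.+1 m.+1 t lm E1'.
by rewrite E1 => -[->].
Qed.

(** Among the first early events of all agents take the earliest one.  The
    events before it are separated, so [gap_le_next] applies to it. *)
Lemma no_early_event i t1 : ~ early_event i t1.
Proof.
move=> early_i.
pose P j := `[< exists t, early_event j t >].
have /choice[f fP] j : exists t,
    P j -> early_event j t /\ forall t', early_event j t' -> t <= t'.
  have [/asboolP/first_early_event[t ? ?]|] := boolP (P j).
    by exists t.
  by exists 0.
have Pi : P i by apply/asboolP; exists t1.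
have [j Pj fmin] := arg_minP f Pi.
have [[l [t0 [E0 E1 lt]]] _] := fP j Pj.
have sep : separated (f j).
  apply: separated_before_early => k t early_k.
  have Pk : P k by apply/asboolP; exists t.
  by apply: le_trans (fmin k Pk) _; apply: (fP k Pk).2.
by have := gap_le_next sep E0 E1; rewrite leNgt lt.
Qed.

Lemma always_separated tau : separated tau.
Proof. by apply: separated_before_early => i t1 /no_early_event. Qed.

Lemma clock_ge0 i t : 0 <= t -> 0 <= clock (q t i).
Proof.
move=> t_ge0; have sep := @always_separated (t + 1).
have ltt : t < t + 1 by rewrite ltrDl.
have [l [t0 [E t0t nx]]] := current_event i sep t_ge0 ltt.
have c0 := clock_event_ge0 sep E (le_trans t0t (ltW ltt)).
by apply: (clock_ge0_step sep E c0 t0t (ltW ltt)) => t1 /nx /ltW.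
Qed.

(** * The Lyapunov function *)

Hypothesis balanced : weight_balanced G.

(** With this weight lambda, the energy term lambda * Y uses up exactly half
    of the decay rate (1 - sigma) * phihat left by the other terms:
    lambda * sigma = (1 - sigma) / 2. *)
Definition jump_weight i := (1 - sigma i) / (2 * sigma i).

Definition lyap t := \sum_i (phys (q t i) ^+ 2 + clock (q t i) +
  jump_weight i * (clock (q t i) + err (q t i) ^+ 2)).

Lemma jump_weight_gt0 i : 0 < jump_weight i.
Proof.
by have /andP[s0 s1] := sigma01 i; rewrite divr_gt0 ?subr_gt0 // mulr_gt0.
Qed.

Lemma decay_rate_gt0 i : 0 < (1 - sigma i) / 2.
Proof. by have /andP[s0 s1] := sigma01 i; rewrite divr_gt0 ?subr_gt0. Qed.

Lemma lyap_term_ge0 i (a b : R) : a <= b ->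
  0 <= (1 - sigma i) / 2 * phihat G (q a) i * (b - a) +
    jump_weight i * (bcast (q b i) - bcast (q a i)) ^+ 2.
Proof.
move=> ab.
have [w0 k0] := (ltW (jump_weight_gt0 i), ltW (decay_rate_gt0 i)).
rewrite addr_ge0 // mulr_ge0 ?sqr_ge0 ?subr_ge0 //.
by rewrite mulr_ge0 ?phihat_ge0.
Qed.

Lemma lyap_ge0 t : 0 <= t -> 0 <= lyap t.
Proof.
move=> t0; apply: sumr_ge0 => i _.
rewrite !addr_ge0 ?sqr_ge0 ?clock_ge0 // mulr_ge0 ?(ltW (jump_weight_gt0 i)) //.
by rewrite addr_ge0 ?sqr_ge0 ?clock_ge0.
Qed.

(** If agent i has an event at b, the left side is 0 and bcast jumps to phys;
    otherwise bcast does not jump.  The same formula covers both cases. *)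
Lemma err_sqr_end i (a b : R) : 0 <= a -> a < b -> event_free tev a b ->
  err (q b i) ^+ 2 = (phys (q b i) - bcast (q a i)) ^+ 2
                     - (bcast (q b i) - bcast (q a i)) ^+ 2.
Proof.
move=> a0 ab free; rewrite /err.
have [[l E]|none] := pselect (exists l, tev i l = Some b).
  have bb1 : b < b + 1 by rewrite ltrDl.
  rewrite (bcast_event (@always_separated (b + 1)) E bb1); ring.
rewrite (eq_bcast (@always_separated b) a0 ab (ltW ab)); first by ring.
move=> l t E /andP[at_]; rewrite le_eqVlt => /predU1P[tb|tb].
  by apply: none; exists l; rewrite E tb.
by apply: (free i l t E); rewrite at_.
Qed.

(** Agent by agent, both sides differ by
    (b - a) * (2 * bcast * zhat - phihat), which sums to 0 by weight
    balance. *)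
Lemma lyap_step (a b : R) : 0 <= a -> a < b -> event_free tev a b ->
  lyap a - lyap b = \sum_i ((1 - sigma i) / 2 * phihat G (q a) i * (b - a) +
    jump_weight i * (bcast (q b i) - bcast (q a i)) ^+ 2).
Proof.
move=> a0 ab free.
have bal0 : \sum_i (b - a) *
    (2 * bcast (q a i) * zhat G (q a) i - phihat G (q a) i) = 0.
  by rewrite -mulr_sumr sumrB sum_bcast_zhat // subrr mulr0.
rewrite -[RHS]addr0 -[X in _ = _ + X]bal0 -big_split /lyap -sumrB /=.
apply: eq_bigr => i _.
have [xb cb] := flow_step i (@always_separated b) a0 ab ab free.
rewrite (err_sqr_end i a0 ab free).
have /(canRL (addrK _)) -> := cb.
rewrite xb /jump_weight /err; field.
by have /andP[s0 _] := sigma01 i; rewrite gt_eqF.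
Qed.

Lemma lyap_step_ge i (a b : R) : 0 <= a -> a < b -> event_free tev a b ->
  (1 - sigma i) / 2 * phihat G (q a) i * (b - a) +
    jump_weight i * (bcast (q b i) - bcast (q a i)) ^+ 2 <= lyap a - lyap b.
Proof.
move=> a0 ab free; rewrite lyap_step // (bigD1 i) //= lerDl sumr_ge0 // => j _.
exact/lyap_term_ge0/ltW.
Qed.

Lemma lyap_rate i (k a b : R) : 0 <= a -> a <= b ->
  (forall s, a <= s -> s < b -> k <= phihat G (q s) i) ->
  (1 - sigma i) / 2 * k * (b - a) <= lyap a - lyap b.
Proof.
move=> a0 ab hk.
pose Q a b := (1 - sigma i) / 2 * k * (b - a) <= lyap a - lyap b.
apply: (@interval_ind b a b Q (@always_separated b)) => //.
- by move=> c; rewrite /Q !subrr mulr0.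
- move=> c d ac cd db free; have c0 := le_trans a0 ac.
  apply: le_trans (lyap_step_ge i c0 cd free); have w0 := jump_weight_gt0 i.
  apply: (@le_trans _ _ ((1 - sigma i) / 2 * phihat G (q c) i * (d - c))).
    rewrite ler_wpM2r ?subr_ge0 ?(ltW cd) //.
    rewrite ler_wpM2l ?(ltW (decay_rate_gt0 i)) //.
    by apply: hk; lra.
  by rewrite lerDl mulr_ge0 ?sqr_ge0 // ltW.
by rewrite /Q => c d e _ _ _ _; lra.
Qed.

Lemma lyap_le (a b : R) : 0 <= a -> a <= b -> lyap b <= lyap a.
Proof.
move=> a0 ab; pose Q a b := lyap b <= lyap a.
apply: (@interval_ind b a b Q (@always_separated b)) => //.
- by move=> c; rewrite /Q.
- move=> c d ac cd db free; have c0 := le_trans a0 ac.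
  rewrite /Q -subr_ge0 lyap_step // sumr_ge0 // => i _.
  exact/lyap_term_ge0/ltW.
by move=> c d e _ _ _ _ cd de; apply: le_trans cd.
Qed.

Lemma event_gap i l m (t t' : R) : tev i l = Some t -> tev i m = Some t' ->
  t < t' -> gap i <= t' - t.
Proof.
move=> E E' tt'; have [lm|ml] := ltnP l m; last first.
  have [s] := event_le ml E; rewrite E' => -[<-]; lra.
have [t1 E1 t1t'] := event_le lm E'.
have t11 : t1 < t1 + 1 by rewrite ltrDl.
by have := always_separated E E1 t11; lra.
Qed.

(** In an interval shorter than gap i agent i has at most one event; so when
    the interval is cut in two, bcast is unchanged on one of the parts, and the
    decrease on the other part accounts for the whole jump. *)
Lemma lyap_jump i (a b : R) : 0 <= a -> a <= b -> b - a < gap i ->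
  jump_weight i * (bcast (q b i) - bcast (q a i)) ^+ 2 <= lyap a - lyap b.
Proof.
move=> a0 ab; have w0 := jump_weight_gt0 i.
pose Q a b := b - a < gap i ->
  jump_weight i * (bcast (q b i) - bcast (q a i)) ^+ 2 <= lyap a - lyap b.
apply: (@interval_ind b a b Q (@always_separated b)) => //.
- by move=> c; rewrite /Q !subrr expr0n mulr0.
- move=> c d ac cd db free _; have c0 := le_trans a0 ac.
  apply: le_trans (lyap_step_ge i c0 cd free).
  rewrite lerDr mulr_ge0 ?subr_ge0 ?(ltW cd) // mulr_ge0 ?phihat_ge0 //.
  exact: ltW (decay_rate_gt0 i).
move=> c d e ac cd de eb hcd hde ce.
have {}hcd := hcd (le_lt_trans (lerB de (lexx c)) ce).
have {}hde := hde (le_lt_trans (lerB (lexx e) cd) ce).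
have c0 := le_trans a0 ac; have d0 := le_trans c0 cd.
have Lcd := lyap_le c0 cd; have Lde := lyap_le d0 de.
have sepe := @always_separated (e + 1).
have [none|some] := pselect (forall l t, tev i l = Some t -> ~ (c < t <= d)).
  by rewrite -(eq_bcast sepe c0 _ cd none); lra.
rewrite (eq_bcast sepe d0 _ de); [lra..|] => l' t' E' /andP[dt' t'e].
apply: some => l t E /andP[ct td].
have := event_gap E E' (le_lt_trans td dt'); lra.
Qed.

(** * Consensus of the broadcast states *)

Lemma lyap_tail (e : R) : 0 < e -> exists2 T0, 0 <= T0 &
  forall a b, T0 <= a -> a <= b -> lyap a - lyap b <= e.
Proof.
move=> e0; pose L := [set lyap t | t in `[0, +oo[%classic].
have lb : lbound L 0.
  by move=> _ [t + <-]; rewrite /= in_itv andbT; exact: lyap_ge0.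
have infL : has_inf L.
  by split; [exists (lyap 0), 0; rewrite //= in_itv /= lexx | exists 0].
have [_ [T0 + <-] T0e] := inf_adherent e0 infL.
rewrite /= in_itv /= andbT => T00; exists T0 => // a b T0a ab.
have Lb : inf L <= lyap b.
  apply: ge_inf; first by exists 0.
  by exists b => //; rewrite /= in_itv /= andbT; lra.
by have := lyap_le T00 T0a; lra.
Qed.

(** Let d bound the variation of [lyap] after t, and let D be the difference of
    the broadcast states of i and j at time t.  On a window of length H shorter
    than both gaps, each of the two broadcast states moves by at most the square
    root of d / jump_weight; so by x^2 >= (x + y + z)^2 / 3 - y^2 - z^2 the
    squared difference stays above
    K = D^2 / 3 - d / jump_weight i - d / jump_weight j.  As phihat_i is then at
    least weight * K, [lyap_rate] bounds K by a multiple of d, and D^2 <= C d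
    with C independent of t. *)
Lemma edge_bcast_cvg i j : edge G i j ->
  bcast (q t i) - bcast (q t j) @[t --> +oo] --> (0 : R).
Proof.
move=> ij.
have [w0 [wi wj]] := (weight_gt0 ij, (jump_weight_gt0 i, jump_weight_gt0 j)).
pose H := Num.min (gap i) (gap j) / 2.
have H0 : 0 < H by rewrite divr_gt0 // lt_min !gap_gt0.
have Hm m : Num.min (gap i) (gap j) <= gap m -> H < gap m.
  by have := gap_gt0 m; rewrite /H; lra.
have Hi : H < gap i by apply: Hm; rewrite ge_min lexx.
have Hj : H < gap j by apply: Hm; rewrite ge_min lexx orbT.
have k0 := decay_rate_gt0 i; set k := (1 - sigma i) / 2 in k0.
pose C := 3 * ((jump_weight i)^-1 + (jump_weight j)^-1 +
  (k * weight G i j * H)^-1).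
have kwH0 : 0 < k * weight G i j * H.
  by apply: mulr_gt0 => //; apply: mulr_gt0.
have C0 : 0 < C.
  by rewrite /C; apply: mulr_gt0 => //; rewrite !addr_gt0 ?invr_gt0.
apply/cvgr0Pnorm_le => e e0.
have [T0 T00 tail] := lyap_tail (divr_gt0 (exprn_gt0 2 e0) C0).
near=> t.
have T0t : T0 <= t by near: t; exact: nbhs_pinfty_ge (num_real _).
have t0 := le_trans T00 T0t.
rewrite -(ler_pXn2r (n := 2)) ?nnegrE ?normr_ge0 ?(ltW e0) //.
rewrite real_normK ?num_real //.
set d := e ^+ 2 / C in tail.
have -> : e ^+ 2 = C * d by rewrite /d; field; rewrite gt_eqF.
set D := bcast (q t i) - bcast (q t j).
have small m s : H < gap m -> t <= s -> s < t + H ->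
    (bcast (q s m) - bcast (q t m)) ^+ 2 <= (jump_weight m)^-1 * d.
  move=> Hgap ts sH; rewrite ler_pdivlMl ?jump_weight_gt0 //.
  by apply: le_trans (tail _ _ T0t ts); apply: lyap_jump => //; lra.
pose K := D ^+ 2 / 3 - (jump_weight i)^-1 * d - (jump_weight j)^-1 * d.
have tH : t <= t + H by lra.
have := lyap_rate (i := i) (k := weight G i j * K) t0 tH _.
have phi_ge s : t <= s -> s < t + H -> weight G i j * K <= phihat G (q s) i.
  move=> ts sH; apply: le_trans (le_phihat _ ij); rewrite ler_pM2l //.
  have := small _ _ Hi ts sH; have := small _ _ Hj ts sH; rewrite /K.
  set y := bcast (q s i) - bcast (q t i); set z := bcast (q s j) - _.
  have -> : D = (bcast (q s i) - bcast (q s j)) + - y + z.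
    by rewrite /D /y /z; ring.
  move: (bcast (q s i) - bcast (q s j)) y z => x y z hz hy.
  have := sqr_ge0 (x + y); have := sqr_ge0 (x - z).
  by have := sqr_ge0 (y + z); lra.
move=> /(_ phi_ge) /le_trans /(_ (tail _ _ T0t tH)).
rewrite -/k => hK.
have hK' : K <= (k * weight G i j * H)^-1 * d.
  rewrite ler_pdivlMl //; apply: le_trans hK.
  by rewrite le_eqVlt; apply/orP; left; apply/eqP; ring.
rewrite /C; move: hK'; rewrite /K; lra.
Unshelve. all: by end_near.
Qed.

End Schedule.

(** * Distance to the target set *)

Section Target.
Variables (R : realType) (N : nat) (G : wdigraph R N).

Lemma connect_bcast_cvg (q : R -> state R N) i j : connect (edge G) i j ->
  (forall i j, edge G i j ->
    bcast (q t i) - bcast (q t j) @[t --> +oo] --> (0 : R)) ->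
  bcast (q t i) - bcast (q t j) @[t --> +oo] --> (0 : R).
Proof.
move=> /connectP[p + ->] hedge; elim: p i => [|k p IH] i /=.
  by move=> _; under eq_fun do rewrite subrr; exact: cvg_cst.
move=> /andP[/hedge ik /IH kp].
under eq_fun => t do rewrite -(subrKA (bcast (q t k))).
by rewrite -[0](addr0 (0 : R)); exact: cvgD.
Qed.

Lemma dist_to_ge0 (A : set (state R N)) p : 0 <= dist_to A p.
Proof.
rewrite /dist_to; have [->|/set0P[p0 Ap0]] := eqVneq A set0.
  by rewrite image_set0 inf0.
apply: lb_le_inf; first by exists (euclid_dist p p0), p0.
by move=> _ [p' _ <-]; exact: sqrtr_ge0.
Qed.

(** The point obtained by giving all agents the broadcast state of i0 lies in
    the target set. *)
Lemma dist_to_target_le (p : state R N) i0 :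
  dist_to (target_set G) p <=
  Num.sqrt (\sum_i (bcast (p i) - bcast (p i0)) ^+ 2).
Proof.
pose p' i := AgentState (phys (p i)) (bcast (p i0)) (clock (p i)).
apply: ge_inf.
  by exists 0 => _ [p'' _ <-]; exact: sqrtr_ge0.
exists p'.
  by move=> i; rewrite /phihat big1 // => j _; rewrite subrr expr0n mulr0.
rewrite /euclid_dist; congr Num.sqrt; apply: eq_bigr => i _ /=.
by rewrite !subrr expr0n add0r addr0.
Qed.

End Target.

Theorem mainTheorem3 (R : realType) (N : nat) (hN : (2 <= N)%N)
    (G : wdigraph R N) (hbal : weight_balanced G)
    (hconn : strongly_connected G)
    (sigma Delta : 'I_N -> R)
    (hsigma : forall i, 0 < sigma i < 1)
    (hDelta : forall i, 0 <= Delta i < sigma i / degree G i)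
    (q : R -> state R N) (tev : 'I_N -> nat -> option R)
    (hq : trajectory G sigma Delta q tev) :
  [/\ forall t : R, 0 <= t -> flow_set (q t),
      (dist_to (target_set G) (q t) @[t --> +oo] --> (0 : R))
    & forall i,
        let T := sigma i / degree G i - Delta i in
        0 < T /\
        forall l t0 t1, tev i l = Some t0 -> tev i l.+1 = Some t1 ->
          T <= t1 - t0].
Proof.
split.
- by move=> t t0 i; exact: (clock_ge0 hsigma hDelta hq).
- have i0 : 'I_N by exists 0%N; exact: ltnW.
  apply: (squeeze_cvgr (f := cst 0) (h := fun t =>
      Num.sqrt (\sum_i (bcast (q t i) - bcast (q t i0)) ^+ 2))).
  + by near=> t; rewrite dist_to_ge0 dist_to_target_le.
  + exact: cvg_cst.
  + suff sum0 :
        \sum_i (bcast (q t i) - bcast (q t i0)) ^+ 2 @[t --> +oo] --> (0 : R).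
      have := continuous_cvg _ (@sqrt_continuous R 0) sum0.
      by rewrite sqrtr0; apply.
    have hedge := edge_bcast_cvg hsigma hDelta hq hbal.
    have sq0 i :
        (bcast (q t i) - bcast (q t i0)) ^+ 2 @[t --> +oo] --> (0 * 0 : R).
      have ci := connect_bcast_cvg (hconn i i0) hedge.
      exact: (cvgM ci ci).
    pose F i t := (bcast (q t i) - bcast (q t i0)) ^+ 2.
    have := @cvg_big _ _ +%R 0 xpredT (@add_continuous R) _ _ (index_enum _)
      F (fun=> 0 * 0) _ (fun i _ => sq0 i).
    by rewrite [X in _ --> X]big1 => [|i _]; [exact | rewrite mulr0].
- move=> i T; split; first exact: (gap_gt0 hDelta).
  move=> l t0 t1 E0 E1.
  have t11 : t1 < t1 + 1 by rewrite ltrDl.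
  exact: (always_separated hsigma hDelta hq E0 E1 t11).
Unshelve. all: by end_near.
Qed.
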